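(* There is a weight-halving bijection from $[\mathcal{P}3_{o}\times\mathcal{P}3]_{\mathsf{even}}$ to $\mathcal{P}3_{o}\times\mathcal{P}3_{o}\times\mathcal{P}3\times\mathcal{P}3$. As a consequence, the numbers $P_{1^{-2}2^{1}4^{2}8^{-1}}(n)$ defined by $\sum_{n\ge0}P_{1^{-2}2^{1}4^{2}8^{-1}}(n)q^n=\frac{f_2f_4^2}{f_1^2f_8}$ form a $2$-convolutive sequence, i.e. $\sum_{n\ge0}P_{1^{-2}2^{1}4^{2}8^{-1}}(2n)q^n=\big(\sum_{n\ge0}P_{1^{-2}2^{1}4^{2}8^{-1}}(n)q^n\big)^2$.
   Context: A partition is a non-increasing finite sequence of positive integers (parts); its weight is the sum of its parts. $\mathcal{P}3$ denotes the set of partitions in which each part size occurs at most $3$ times, and $\mathcal{P}3_{o}$ the set of such partitions all of whose parts are odd. The weight of a tuple of partitions is the sum of the weights of its components. For a set $\mathcal{U}$ of weighted objects, $[\mathcal{U}]_{\mathsf{even}}$ is the subset of members of even weight. A bijection is weight-halving if the weight of the image is half the weight of the object. $f_i:=(q^i;q^i)_\infty=\prod_{k\ge1}(1-q^{ik})$. A sequence $(a_n)_{n\ge0}$ is $m$-convolutive if $\sum_{n\ge0}a_{mn}q^n=\big(\sum_{n\ge0}a_nq^n\big)^m$. *)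

(* Defs.v *)
From mathcomp Require Import all_boot all_order all_algebra.
Set Implicit Arguments. Unset Strict Implicit. Unset Printing Implicit Defensive.
Import GRing.Theory.
Local Open Scope ring_scope.

Definition is_partition (s : seq nat) : bool :=
  sorted geq s && all (fun x => (0 < x)%N) s.

Definition weight (s : seq nat) : nat := sumn s.

Definition P3 (s : seq nat) : bool :=
  is_partition s && all (fun x => (count_mem x s <= 3)%N) s.

Definition P3o (s : seq nat) : bool := P3 s && all odd s.

Definition DomEven : Type :=
  { x : seq nat * seq nat |
      P3o x.1 && P3 x.2 && ~~ odd (weight x.1 + weight x.2) }.

Definition Cod4 : Type :=
  { y : (seq nat * seq nat) * (seq nat * seq nat) |
      [&& P3o y.1.1, P3o y.1.2, P3 y.2.1 & P3 y.2.2] }.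

Definition weight_dom (x : DomEven) : nat :=
  (weight (sval x).1 + weight (sval x).2)%N.

Definition weight_cod (y : Cod4) : nat :=
  (weight (sval y).1.1 + weight (sval y).1.2
   + weight (sval y).2.1 + weight (sval y).2.2)%N.

Definition fps := nat -> int.

Definition fps_mul (a b : fps) : fps :=
  fun n => \sum_(i < n.+1) a i * b (n - i)%N.

(* f_i = prod_{k>=1} (1 - q^{ik}); for i >= 1 its coefficient of q^n equals
   the coefficient of q^n in the finite product over 1 <= k <= n. *)
Definition feta (i : nat) : fps :=
  fun n => (\prod_(1 <= k < n.+1) (1 - 'X^(i * k)) : {poly int})`_n.

(* The power series identity  A * f1^2 * f8 = f2 * f4^2, i.e.
   A = f2 f4^2 / (f1^2 f8). *)
Definition is_gf_P (a : fps) : Prop :=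
  forall n, fps_mul (fps_mul (fps_mul a (feta 1)) (feta 1)) (feta 8) n
          = fps_mul (fps_mul (feta 2) (feta 4)) (feta 4) n.

(* Main.v *)
From Stdlib Require Import Setoid Morphisms.
Require Import Defs.
From mathcomp Require Import all_boot all_order all_algebra.
From mathcomp Require Import zify ring.

(* Write f_i for the product of the 1 - q^(ik) and F = f_2 f_4^2 / (f_1^2 f_8),
   which is the generating function of P3o x P3. Gauss's product formula
   sum_(j in Z) q^(j^2) = theta(q) = f_2^5 / (f_1^2 f_4^2), the limit of the
   symmetric q-binomial theorem, gives F = theta(q) f_4^4 / (f_2^4 f_8). In this
   expression only theta(q) has odd powers, and its even part is theta(q^4);
   applying Gauss's formula once more to theta(q^4) turns the even part of F
   into F(q^2)^2. Comparing coefficients, both sides of the required bijection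
   have equally many elements in each weight, so an enumeration weight by weight
   yields the bijection. Power series are handled as integer polynomials modulo
   X^N, with [eta i m] the product f_i truncated at k = m. *)

Set Implicit Arguments.
Unset Strict Implicit.
Unset Printing Implicit Defensive.
Import GRing.Theory Num.Theory.
Local Open Scope ring_scope.

(** * Gaussian binomials and the q-binomial theorem *)

Section GaussianBinomial.
Variable R : comNzRingType.
Implicit Types t x y : R.

(** The q-Pascal rule defines the Gaussian binomial without dividing by factors 1 - t^i. *)
Fixpoint gauss_binom t n k : R :=
  match n, k with
  | _, 0 => 1
  | 0, _.+1 => 0
  | n'.+1, k'.+1 => gauss_binom t n' k' + t ^+ k * gauss_binom t n' k
  end.

Definition qfact t n : R := \prod_(1 <= i < n.+1) (1 - t ^+ i).

Lemma qfactS t n : qfact t n.+1 = qfact t n * (1 - t ^+ n.+1).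
Proof. by rewrite /qfact big_nat_recr. Qed.

Lemma gauss_binom0 t n : gauss_binom t n 0 = 1. Proof. by case: n. Qed.

Lemma gauss_binomS t n k : gauss_binom t n.+1 k.+1 =
  gauss_binom t n k + t ^+ k.+1 * gauss_binom t n k.+1.
Proof. by []. Qed.

Lemma gauss_binom_small t n k : (n < k)%N -> gauss_binom t n k = 0.
Proof.
elim: n k => [|n IH] [|k] //= lt_nk.
by rewrite !IH ?mulr0 ?addr0 // ltnW.
Qed.

(** The quotient formula with denominators cleared. By the q-Pascal rule, the induction step reduces
    to 1 - t^(n+1) = (1 - t^(k+1)) + t^(k+1) (1 - t^(n-k)). *)
Lemma gauss_binom_fact t n k : (k <= n)%N ->
  gauss_binom t n k * qfact t k * qfact t (n - k) = qfact t n.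
Proof.
elim: n k => [|n IH] [|k] //.
- by rewrite /qfact !big_nil !mulr1.
- by rewrite gauss_binom0 subn0 mul1r /qfact big_nil mul1r.
rewrite ltnS gauss_binomS => le_kn; rewrite subSS !qfactS.
case: (ltngtP k n) le_kn => // [lt_kn _|-> _]; last first.
  by rewrite (gauss_binom_small t (ltnSn n)) -{2}(IH n) // !subnn; ring.
have IH1 := IH k (ltnW lt_kn); have IH2 := IH k.+1 lt_kn.
have E : (n - k = (n - k.+1).+1)%N by lia.
rewrite E qfactS in IH1 *; rewrite qfactS in IH2.
transitivity (qfact t n * (1 - t ^+ k.+1)
   + t ^+ k.+1 * qfact t n * (1 - t ^+ (n - k.+1).+1)).
  by rewrite -{1}IH1 -IH2; ring.
have -> : t ^+ n.+1 = t ^+ k.+1 * t ^+ (n - k.+1).+1.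
  by rewrite -exprD; congr (_ ^+ _); lia.
ring.
Qed.

(** Splitting off the factor i = 0 leaves the same product with x replaced by x t, so the induction
    keeps x general. *)
Lemma gauss_binomial_theorem t x y m :
  \prod_(i < m) (y + x * t ^+ i) =
  \sum_(k < m.+1) t ^+ 'C(k, 2) * gauss_binom t m k * x ^+ k * y ^+ (m - k).
Proof.
elim: m x => [|m IH] x.
  by rewrite big_ord0 big_ord_recl big_ord0 /= !expr0 !mulr1 addr0.
rewrite big_ord_recl /=.
under eq_bigr do rewrite /bump /= add1n exprS mulrA.
rewrite IH expr0 mulr1 mulrDl [RHS]big_ord_recl /= subn0.
set S := \sum_(k < m.+1) _.
(* The added term k = m+1 vanishes; it aligns the sum with the right-hand side for the q-Pascal
   rule. *)
have -> : y * S = \sum_(k < m.+2)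
    t ^+ 'C(k, 2) * gauss_binom t m k * (x * t) ^+ k * y ^+ (m.+1 - k).
  rewrite big_ord_recr /= gauss_binom_small // mulr0 !mul0r addr0 mulr_sumr.
  by apply: eq_bigr => k _; rewrite subSn -1?ltnS // exprS; ring.
rewrite big_ord_recl /= gauss_binom0 subn0 !expr0 -addrA; congr (_ + _).
rewrite mulr_sumr -big_split /=; apply: eq_bigr => k _.
by rewrite /bump /= add1n subSS binS bin1 !exprMn exprD !exprS; ring.
Qed.
End GaussianBinomial.

(** * Congruence of integer polynomials modulo X^N *)

Definition eqmodX N (p q : {poly int}) : Prop :=
  forall i, (i < N)%N -> p`_i = q`_i.

Lemma eqmodX_refl N p : eqmodX N p p. Proof. by []. Qed.

Lemma eq_eqmodX N p q : p = q -> eqmodX N p q. Proof. by move->. Qed.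

Lemma eqmodX_sym N p q : eqmodX N p q -> eqmodX N q p.
Proof. by move=> pq i lt_iN; rewrite pq. Qed.

Lemma eqmodX_trans N p q r : eqmodX N p q -> eqmodX N q r -> eqmodX N p r.
Proof. by move=> pq qr i lt_iN; rewrite pq ?qr. Qed.

Add Parametric Relation N : {poly int} (eqmodX N)
  reflexivity proved by (@eqmodX_refl N)
  symmetry proved by (@eqmodX_sym N)
  transitivity proved by (@eqmodX_trans N) as eqmodX_rel.

Add Parametric Morphism N : (@GRing.add {poly int}) with signature
  eqmodX N ==> eqmodX N ==> eqmodX N as eqmodX_add.
Proof. by move=> p p' pp' q q' qq' i lt_iN; rewrite !coefD pp' ?qq'. Qed.

Add Parametric Morphism N : (@GRing.mul {poly int}) with signature
  eqmodX N ==> eqmodX N ==> eqmodX N as eqmodX_mul.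
Proof.
move=> p p' pp' q q' qq' i lt_iN; rewrite !coefM; apply: eq_bigr => j _.
by rewrite pp' ?qq' //; have := ltn_ord j; lia.
Qed.

Add Parametric Morphism N : (fun (p : {poly int}) k => p ^+ k) with signature
  eqmodX N ==> @eq nat ==> eqmodX N as eqmodX_exp.
Proof.
move=> p p' pp' k; elim: k => [|k IH]; first by rewrite !expr0.
by rewrite !exprS IH pp'.
Qed.

Lemma eqmodX_sum N (I : Type) (r : seq I) (P : pred I) (F G : I -> {poly int}) :
  (forall i, P i -> eqmodX N (F i) (G i)) ->
  eqmodX N (\sum_(i <- r | P i) F i) (\sum_(i <- r | P i) G i).
Proof.
move=> FG; elim/big_rec2: _ => // i p q Pi pq; by rewrite pq FG.
Qed.

Lemma eqmodX_prod1 N (I : eqType) (r : seq I) (P : pred I) (F : I -> {poly int}) :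
  (forall i, i \in r -> P i -> eqmodX N (F i) 1) ->
  eqmodX N (\prod_(i <- r | P i) F i) 1.
Proof.
move=> F1; rewrite big_seq_cond.
elim/big_rec: _ => // i p /andP[ri Pi] ->; by rewrite F1 // mulr1.
Qed.

Lemma eqmodX_le M N p q : (M <= N)%N -> eqmodX N p q -> eqmodX M p q.
Proof. by move=> leMN pq i lt_iM; apply/pq/(leq_trans lt_iM). Qed.

Lemma eqmodX_mulXn N k p q :
  eqmodX N p q -> eqmodX (k + N) ('X^k * p) ('X^k * q).
Proof.
move=> pq i lt_i; rewrite !coefXnM; case: ltnP => // le_ki.
by apply: pq; lia.
Qed.

Lemma eqmodX_Xn N k : (N <= k)%N -> eqmodX N 'X^k 0.
Proof.
by move=> le_Nk i lt_iN; rewrite coefXn coef0; case: eqP => // ?; lia.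
Qed.

(** Constant term 1 makes a invertible as a power series. By strong induction on i, the other terms
    of the two convolutions involve only earlier coefficients of p and q, and cancel. *)
Lemma eqmodX_cancel N (a p q : {poly int}) : a`_0 = 1 ->
  eqmodX N (a * p) (a * q) -> eqmodX N p q.
Proof.
move=> a0 apq i; have [n] := ubnP i; elim: n i => // n IH i le_in lt_iN.
have := apq i lt_iN; rewrite !coefM !big_ord_recl a0 !mul1r subn0 => E.
apply: (addIr (\sum_(j < i) a`_(lift ord0 j) * p`_(i - lift ord0 j))).
rewrite E; congr (_ + _); apply: eq_bigr => j _; congr (_ * _).
by rewrite lift0; apply/esym/IH; have := ltn_ord j; lia.
Qed.

(** * Truncated products f_i *)

Definition eta i m : {poly int} := \prod_(1 <= k < m.+1) (1 - 'X^(i * k)).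

Lemma coef0_1B (k : nat) : (0 < k)%N -> (1 - 'X^k : {poly int})`_0 = 1.
Proof. by rewrite coefB coef1 coefXn; case: k. Qed.

Lemma coef0_eta i m : (0 < i)%N -> (eta i m)`_0 = 1.
Proof.
move=> i_gt0; rewrite /eta big_seq_cond.
elim/big_rec: _ => [|k p]; first by rewrite coef1.
rewrite mem_index_iota coef0M => /andP[/andP[k_gt0 _] _] ->.
by rewrite coef0_1B // muln_gt0 i_gt0.
Qed.

(** Every further factor has k > m and is 1 modulo X^(i(m+1)). *)
Lemma eta_stable N i m n : (N <= i * m.+1)%N -> (m <= n)%N ->
  eqmodX N (eta i m) (eta i n).
Proof.
move=> le_N le_mn; rewrite /eta [X in eqmodX _ _ X](big_cat_nat _ (n := m.+1)) //=.
rewrite [X in eqmodX _ _ (_ * X)](_ : eqmodX N _ 1) ?mulr1 //.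
apply: eqmodX_prod1 => k; rewrite mem_index_iota => /andP[le_mk _] _.
move=> j lt_jN; rewrite coefB coefXn; case: eqP => [jk|_]; last by rewrite subr0.
by have : (i * m.+1 <= i * k)%N; [rewrite leq_mul2l le_mk orbT | lia].
Qed.

(** * Theta as the limit of the symmetric q-binomial theorem *)

Definition odd_prod m : {poly int} := \prod_(0 <= k < m) (1 + 'X^(2 * k + 1)).

(** This is (m - k)^2: one of the two truncated differences is always zero. *)
Definition sqdist (m k : nat) : nat := ((m - k + (k - m)) ^ 2)%N.

Lemma bin2_double k : ('C(k, 2) * 2 = k * k.-1)%N.
Proof. by elim: k => // -[|k] IH; rewrite // binS bin1 mulnDl IH /=; nia. Qed.

(** Completing the square in the exponent of the k-th term of the q-binomial theorem. Writing the
    larger of m and k as a sum removes the truncated subtractions. *)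
Lemma sqdist_exponent m k : (k <= 2 * m)%N ->
  (k * k.-1 + (2 * m).-1 * (2 * m - k) =
   m * m.-1 + m * (2 * m).-1 + sqdist m k)%N.
Proof.
rewrite /sqdist; case: (leqP k m) => [le_km|/ltnW le_mk] le_k.
  have -> : (k - m = 0)%N by lia.
  have [d ->] : exists d, m = (k + d)%N by exists (m - k)%N; lia.
  rewrite addKn; case: k {le_km le_k} => [|k]; case: d => [|d]; nia.
have -> : (m - k = 0)%N by lia.
have [d dE] : exists d, k = (m + d)%N by exists (k - m)%N; lia.
subst k; rewrite addKn; case: m le_k {le_mk} => [|m] le_k.
  by have -> : d = 0%N by lia.
have [c cE] : exists c, m.+1 = (d + c)%N by exists (m.+1 - d)%N; lia.
have -> : (2 * m.+1 - (m.+1 + d) = c)%N by lia.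
nia.
Qed.

(* The q-binomial theorem with q replaced by X^2, x = 1 and y = X^(2m-1); the
   common factor X^e clears the negative exponents of the symmetric form. *)
Lemma odd_prod_sqr m :
  odd_prod m ^+ 2 =
  \sum_(k < (2 * m).+1) gauss_binom ('X^2) (2 * m) k * 'X^(sqdist m k).
Proof.
pose e := (m * m.-1 + m * (2 * m).-1)%N.
have nz : 'X^e != 0 :> {poly int} by rewrite monic_neq0 ?monicXn.
apply: (mulfI nz); have /= := gauss_binomial_theorem ('X^2 : {poly int}) 1
  'X^((2 * m).-1) (2 * m).
rewrite -(big_mkord predT (fun i => 'X^((2 * m).-1) + 1 * 'X^2 ^+ i)).
rewrite (@big_cat_nat _ _ _ m) //=; last by lia.
(* For i < m, pulling out X^(2i) leaves 1 + X^(2(m-i-1)+1), the odd exponents in reverse order; for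
   i >= m, X^(2m-1) is pulled out instead. *)
rewrite (_ : \prod_(0 <= i < m) _ = 'X^(m * m.-1) * odd_prod m); last first.
  transitivity (\prod_(0 <= i < m) ('X^(2 * i) * (1 + 'X^(2 * (m - i.+1) + 1))
    : {poly int})).
    rewrite big_nat_cond [RHS]big_nat_cond; apply: eq_bigr => i.
    rewrite andbT => /andP[_ lt_im]; rewrite mul1r -exprM mulrDr mulr1 -exprD.
    by rewrite addrC; congr (_ + 'X^ _); lia.
  rewrite big_split /=; congr (_ * _); last first.
    by rewrite /odd_prod [RHS]big_nat_rev /=; apply: eq_bigr => i _; rewrite add0n.
  elim: (m) => [|k IH]; first by rewrite big_nil.
  by rewrite big_nat_recr //= IH -exprD; congr (_ ^+ _); case: k {IH} => [|k] /=; nia.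
rewrite (_ : \prod_(m <= i < 2 * m) _ = 'X^(m * (2 * m).-1) * odd_prod m); last first.
  rewrite -{1}[m]add0n big_addn (_ : 2 * m - m = m)%N; last by lia.
  transitivity (\prod_(0 <= i < m) ('X^((2 * m).-1) * (1 + 'X^(2 * i + 1))
    : {poly int})).
    rewrite big_nat_cond [RHS]big_nat_cond; apply: eq_bigr => i.
    rewrite andbT => /andP[_ lt_im]; rewrite mul1r -exprM mulrDr mulr1 -exprD.
    by congr (_ + 'X^ _); lia.
  by rewrite big_split /= prodr_const_nat subn0 -exprM mulnC.
rewrite mulrACA -exprD -/e -expr2 => ->; rewrite mulr_sumr.
apply: eq_bigr => k _; rewrite expr1n mulr1 -!exprM mulrAC [RHS]mulrCA -!exprD.
rewrite mulrC; congr (_ * 'X^ _).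
by rewrite mulnC bin2_double /e -sqdist_exponent // -ltnS.
Qed.

Lemma qfact_eta m : qfact ('X^2 : {poly int}) m = eta 2 m.
Proof. by apply: eq_bigr => k _; rewrite -exprM. Qed.

(** The theta series cut to |j| <= m, with the terms of j and -j merged. *)
Definition theta m : {poly int} := 1 + \sum_(1 <= j < m.+1) 'X^(j ^ 2) *+ 2.

(** The substitution j = k - m; the ranges k < m and k > m are the two signs of j. *)
Lemma theta_sqdist m : theta m = \sum_(k < (2 * m).+1) 'X^(sqdist m k).
Proof.
rewrite -(big_mkord predT (fun k => 'X^(sqdist m k))).
rewrite (@big_cat_nat _ _ _ m) //=; last by lia.
rewrite [X in _ = _ + X]big_nat_recl; last by lia.
rewrite [X in _ = X + _]big_nat_rev /=.
have shift (F : nat -> {poly int}) :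
    \sum_(m <= i < 2 * m) F i = \sum_(0 <= j < m) F (j + m)%N.
  rewrite -{1}[m]add0n big_addn; congr (\sum_(0 <= j < _) _); lia.
rewrite shift /sqdist subnn addrCA /theta; congr (_ + _).
rewrite big_add1 /= -big_split /= big_nat_cond [RHS]big_nat_cond.
apply: eq_bigr => j; rewrite andbT => /andP[_ lt_jm].
by rewrite mulr2n; congr ('X^ _ + 'X^ _); congr (_ ^ 2)%N; lia.
Qed.

(* With r = |m - k|, the binomial is only known modulo X^(2(m-r+1)), but its
   weight X^(r^2) makes up for the loss since r^2 - 2r + 2 > 0. *)
Lemma gauss_binom_limit m k : (k <= 2 * m)%N ->
  eqmodX (2 * m) (eta 2 m * gauss_binom ('X^2) (2 * m) k * 'X^(sqdist m k))
    'X^(sqdist m k).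
Proof.
move=> le_k; set g := gauss_binom _ _ _.
pose r := (m - k + (k - m))%N; pose N := (2 * (m - r).+1)%N.
have stable n : (m - r <= n)%N -> eqmodX N (eta 2 n) (eta 2 (m - r)).
  by move=> le_n; apply: eqmodX_sym; apply: eta_stable.
(* Each of k, 2m - k and 2m is at least m - r, so all three q-factorials agree with [eta 2 (m - r)]
   modulo X^N, and one copy cancels. *)
have g_eta : eqmodX N (eta 2 (m - r) * g) 1.
  apply: (@eqmodX_cancel N (eta 2 (m - r))); first exact: coef0_eta.
  have := gauss_binom_fact ('X^2 : {poly int}) le_k; rewrite !qfact_eta -/g => E.
  rewrite mulr1 -[X in eqmodX _ _ X](stable (2 * m)%N); last by rewrite /r; lia.
  rewrite -E (stable k); last by rewrite /r; lia.
  rewrite (stable (2 * m - k)%N); last by rewrite /r; lia.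
  by rewrite mulrA mulrC mulrA.
rewrite mulrC -[X in eqmodX _ _ X]mulr1.
apply: (@eqmodX_le _ (sqdist m k + N)); last first.
  by apply: eqmodX_mulXn; rewrite stable // leq_subr.
rewrite /sqdist -/r /N; case: (leqP r m) => ?; nia.
Qed.

(** The Jacobi triple product at z = 1, by passing to the limit term by term. *)
Lemma jacobi_theta m : eqmodX (2 * m) (eta 2 m * odd_prod m ^+ 2) (theta m).
Proof.
rewrite odd_prod_sqr theta_sqdist mulr_sumr; apply: eqmodX_sum => k _.
by rewrite mulrA; apply: gauss_binom_limit; rewrite -ltnS.
Qed.

Lemma theta_stable N m n : (N <= m.+1)%N -> (m <= n)%N ->
  eqmodX N (theta m) (theta n).
Proof.
move=> le_N le_mn; rewrite /theta.
rewrite [X in eqmodX _ _ (_ + X)](@big_cat_nat _ _ _ m.+1) //= addrA.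
have tail : eqmodX N (\sum_(m.+1 <= j < n.+1) 'X^(j ^ 2) *+ 2) 0.
  rewrite big_nat_cond; elim/big_rec: _ => // j p /andP[/andP[le_mj _] _] ->.
  by rewrite addr0 mulr2n eqmodX_Xn ?addr0 //; nia.
by rewrite tail addr0.
Qed.

(** * Even parts and the substitution of X^2 for X *)

(** In even degree, odd coefficients of p meet only odd coefficients of r(X^2), which vanish. *)
Lemma even_polyM_comp (p r : {poly int}) :
  even_poly (p * (r \Po 'X^2)) = even_poly p * r.
Proof.
apply/polyP => i; rewrite coef_even_poly !coefM.
have split_sum (F : nat -> int) n :
    \sum_(j < n.*2.+1) F j = \sum_(j < n.+1) F j.*2 + \sum_(j < n) F j.*2.+1.
  elim: n => [|n IH]; first by rewrite !big_ord_recr !big_ord0 /= addr0.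
  by rewrite doubleS !big_ord_recr /= in IH *; rewrite IH; ring.
rewrite (split_sum (fun j => p`_j * (r \Po 'X^2)`_(i.*2 - j))).
rewrite [X in _ + X]big1 ?addr0 => [|j _]; last first.
  rewrite coef_comp_poly_Xn // ifF ?mulr0 //.
  by have := ltn_ord j; rewrite dvdn2; lia.
apply: eq_bigr => j _; have := ltn_ord j => lt_j.
rewrite coef_even_poly coef_comp_poly_Xn // ifT; last by rewrite dvdn2; lia.
by congr (_ * r`_ _); lia.
Qed.

Lemma even_poly_eqmodX N p q :
  eqmodX (2 * N) p q -> eqmodX N (even_poly p) (even_poly q).
Proof. by move=> pq i lt_iN; rewrite !coef_even_poly pq //; lia. Qed.

Lemma comp_X2_eqmodX N p q :
  eqmodX N p q -> eqmodX (2 * N) (p \Po 'X^2) (q \Po 'X^2).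
Proof.
move=> pq i lt_iN; rewrite !coef_comp_poly_Xn //; case: ifP => // _.
by apply: pq; lia.
Qed.

Lemma eta_comp i m : eta i m \Po 'X^2 = eta (2 * i) m.
Proof.
rewrite /eta rmorph_prod /=; apply: eq_bigr => k _.
by rewrite comp_polyB comp_polyC comp_Xn_poly -exprM mulnA.
Qed.

Lemma even_polyXn n :
  even_poly ('X^n : {poly int}) = if odd n then 0 else 'X^(n./2).
Proof.
apply/polyP => i; rewrite coef_even_poly coefXn.
case: ifP => odd_n; rewrite ?coef0 ?coefXn.
  by rewrite (_ : (_ == _) = false) //; lia.
by congr (nat_of_bool _)%:R; lia.
Qed.

Lemma thetaS m : theta m.+1 = theta m + 'X^(m.+1 ^ 2) *+ 2.
Proof. by rewrite /theta big_nat_recr //= addrA. Qed.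

(** Only even j have an even square, and (2j)^2 / 2 = 2 j^2. Since [even_poly] halves degrees,
    theta(q^4) appears as theta(q^2). *)
Lemma even_poly_theta m : even_poly (theta (2 * m)) = theta m \Po 'X^2.
Proof.
elim: m => [|m IH]; first by rewrite /theta !big_nil addr0 even_polyC comp_polyC.
move: theta thetaS IH => T TS IH.
rewrite (_ : 2 * m.+1 = (2 * m).+2)%N ?mulnS // !TS !mulr2n.
rewrite !even_polyD !comp_polyD IH !even_polyXn comp_Xn_poly.
rewrite ifT; last by lia.
rewrite ifF; last by lia.
by rewrite !addr0 -exprM; congr (_ + ('X^ _ + 'X^ _)); lia.
Qed.

(** * Gauss's product formula for theta *)

Definition eta_odd i m : {poly int} :=
  \prod_(0 <= k < m) (1 - 'X^(i * (2 * k + 1))).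

Lemma etaS i m : eta i m.+1 = eta i m * (1 - 'X^(i * m.+1)).
Proof. by rewrite /eta big_nat_recr. Qed.

Lemma eta_parity i m : eta i (2 * m) = eta_odd i m * eta (2 * i) m.
Proof.
elim: m => [|m IH]; first by rewrite /eta /eta_odd !big_nil mulr1.
rewrite (_ : 2 * m.+1 = (2 * m).+2)%N ?mulnS // !etaS IH /eta_odd big_nat_recr //=.
rewrite (_ : 2 * i * m.+1 = i * (2 * m).+2)%N; last by lia.
by rewrite addn1; ring.
Qed.

Lemma odd_prod_eta m : odd_prod m * eta_odd 1 m = eta_odd 2 m.
Proof.
rewrite -big_split; apply: eq_bigr => k _ /=.
by rewrite mul1n (mulnC 2 (2 * k + 1)%N) exprM; ring.
Qed.

Lemma eta_eqmodX N i m n : (0 < i)%N -> (N <= m)%N -> (N <= n)%N ->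
  eqmodX N (eta i m) (eta i n).
Proof.
by move=> i_gt0 le_m le_n; rewrite -!(@eta_stable N i N) //; nia.
Qed.

(** In the limit [eta_odd i] is f_i / f_(2i), so [odd_prod] is f_2^2 / (f_1 f_4); this is inserted
    into [jacobi_theta]. *)
Lemma gauss_theta N m n : (N <= m)%N -> (N <= n)%N ->
  eqmodX N (theta m * eta 1 n ^+ 2 * eta 4 n ^+ 2) (eta 2 n ^+ 5).
Proof.
move=> le_m le_n.
rewrite -(@theta_stable N N m) //.
(* Cutting [eta 1] at 2N lets [eta_parity] split it into pieces cut at N, which makes the identity
   below exact. *)
rewrite (@eta_eqmodX N 1 n (2 * N)) ?(@eta_eqmodX N 2 n N) //; try lia.
rewrite (@eta_eqmodX N 4 n N) //.
rewrite -(eqmodX_le (leq_pmull N (isT : 0 < 2)%N) (@jacobi_theta N)).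
rewrite (_ : _ * _ = eta 2 N ^+ 3 * eta 2 (2 * N) ^+ 2).
  by rewrite (@eta_eqmodX N 2 (2 * N) N) //; [rewrite -exprD | lia].
rewrite (eta_parity 1) (eta_parity 2) muln1 -odd_prod_eta.
ring.
Qed.

(** * The even part of F *)

Lemma even_part_sqr N n p : (2 * N <= n)%N ->
  eqmodX (2 * N) (p * eta 1 n ^+ 2 * eta 8 n) (eta 2 n * eta 4 n ^+ 2) ->
  eqmodX N (even_poly p) (p ^+ 2).
Proof.
move=> le_n Hp.
have c0 i : (0 < i)%N -> (eta i n)`_0 = 1 by exact: coef0_eta.
(* Taking even parts halves the precision, hence the modulus X^(2N). *)
have G1 : eqmodX (2 * N) (theta (2 * n) * eta 1 n ^+ 2 * eta 4 n ^+ 2) (eta 2 n ^+ 5).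
  by apply: gauss_theta; lia.
have G2 : eqmodX N ((theta n \Po 'X^2) * eta 2 n ^+ 2 * eta 8 n ^+ 2) (eta 4 n ^+ 5).
  have le_Nn : (N <= n)%N by lia.
  have := comp_X2_eqmodX (gauss_theta le_Nn le_Nn).
  by rewrite !(rmorphXn, rmorphM) /= !eta_comp; apply: eqmodX_le; lia.
(* This is p f_8 f_2^4 = theta f_4^4, with the products f_i written in X^2 so that they pass through
   [even_poly]. *)
have H1 : eqmodX (2 * N) (p * ((eta 4 n * eta 1 n ^+ 4) \Po 'X^2))
                         (theta (2 * n) * ((eta 2 n ^+ 4) \Po 'X^2)).
  rewrite !(rmorphXn, rmorphM) /= !eta_comp.
  apply: (@eqmodX_cancel _ (eta 1 n ^+ 2)); first by rewrite expr2 coef0M !c0.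
  transitivity (p * eta 1 n ^+ 2 * eta 8 n * eta 2 n ^+ 4).
    by apply: eq_eqmodX; ring.
  rewrite Hp.
  transitivity (eta 2 n ^+ 5 * eta 4 n ^+ 2).
    by apply: eq_eqmodX; ring.
  by rewrite -G1; apply: eq_eqmodX; ring.
have := even_poly_eqmodX H1; rewrite !even_polyM_comp even_poly_theta => H2.
(* c joins the multiplier f_4 f_1^4 of [H2] to f_2^2 f_8^2 of [G2]; both sides become f_4^5
   f_2^4. *)
pose c := eta 1 n ^+ 4 * eta 8 n ^+ 2 * eta 4 n * eta 2 n ^+ 2.
apply: (@eqmodX_cancel _ c).
  by rewrite /c !exprS !expr0 !coef0M !c0 // !coef1.
transitivity (eta 4 n ^+ 5 * eta 2 n ^+ 4).
  rewrite (_ : c * _ = even_poly p * (eta 4 n * eta 1 n ^+ 4)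
                       * (eta 2 n ^+ 2 * eta 8 n ^+ 2)); last by rewrite /c; ring.
  by rewrite H2 -G2; apply: eq_eqmodX; ring.
have Hp' := eqmodX_le (leq_pmull N (isT : 0 < 2)%N) Hp.
rewrite (_ : c * _ = (p * eta 1 n ^+ 2 * eta 8 n) ^+ 2 * (eta 4 n * eta 2 n ^+ 2));
  last by rewrite /c; ring.
by rewrite Hp'; apply: eq_eqmodX; ring.
Qed.

(** * From formal power series to truncated polynomials *)

Definition represents N (a : fps) (p : {poly int}) : Prop :=
  forall i, (i < N)%N -> a i = p`_i.

Lemma represents_mul N a b p q : represents N a p -> represents N b q ->
  represents N (fps_mul a b) (p * q).
Proof.
move=> ap bq i lt_iN; rewrite coefM; apply: eq_bigr => j _.
by rewrite ap ?bq //; have := ltn_ord j; lia.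
Qed.

(** Coefficient j of [feta i] is read off the product cut at k = j, which already agrees with the
    longer one up to degree j. *)
Lemma represents_feta N i n : (0 < i)%N -> (N <= n)%N ->
  represents N (feta i) (eta i n).
Proof.
move=> i_gt0 le_Nn j lt_jN; apply: (@eta_stable j.+1) => //; nia.
Qed.

Lemma gf_convolutive (P : fps) : is_gf_P P ->
  forall n, P (2 * n)%N = fps_mul P P n.
Proof.
(* Truncation at M = 2(n+1) retains the coefficient of degree 2n. *)
move=> gfP n; pose N := n.+1; pose M := (2 * N)%N.
pose p : {poly int} := \poly_(i < M) P i.
have Pp : represents M P p by move=> i lt_i; rewrite coef_poly lt_i.
have fE i : (0 < i)%N -> represents M (feta i) (eta i M).
  by move=> i_gt0; apply: represents_feta.
have Hp : eqmodX M (p * eta 1 M ^+ 2 * eta 8 M) (eta 2 M * eta 4 M ^+ 2).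
  have L := represents_mul (represents_mul (represents_mul Pp (fE 1 isT))
    (fE 1 isT)) (fE 8 isT).
  have R := represents_mul (represents_mul (fE 2 isT) (fE 4 isT)) (fE 4 isT).
  by move=> i lt_iM; rewrite !expr2 !mulrA -L // -R // gfP.
have E := even_part_sqr (leqnn _) Hp.
have := E n (ltnSn n); rewrite coef_even_poly -mul2n -Pp; last by rewrite /M; lia.
by move->; rewrite expr2 (represents_mul Pp Pp) // /M /N; lia.
Qed.

(** * Enumeration of partitions with multiplicities at most 3 *)

(** The recursion chooses the multiplicity c of the largest allowed part; placing its copies first
    keeps the sequence non-increasing. *)
Fixpoint p3list (A : pred nat) n : seq (seq nat) :=
  if n is n'.+1 then
    if A n then [seq nseq c n ++ s | c <- iota 0 4, s <- p3list A n']
    else p3list A n'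
  else [:: [::]].

Lemma p3listS A n : p3list A n.+1 =
  if A n.+1 then [seq nseq c n.+1 ++ s | c <- iota 0 4, s <- p3list A n]
  else p3list A n.
Proof. by []. Qed.

Lemma sorted_nseq_cat n c s : all (geq n) s ->
  sorted geq (nseq c n ++ s) = sorted geq s.
Proof.
have geq_trans : transitive geq by move=> y x z /= yx zy; apply: leq_trans yx.
move=> le_s; rewrite !sorted_pairwise // pairwise_cat.
have -> : pairwise geq (nseq c n).
  by elim: c => //= c ->; rewrite all_nseq /= leqnn orbT.
rewrite (_ : allrel _ _ _) //.
by apply/allrelP => x y /nseqP[-> _] /(allP le_s).
Qed.

(** Both sides are sorted and permutations of each other. *)
Lemma sorted_decomp n s : sorted geq s -> all (geq n) s ->
  s = nseq (count_mem n s) n ++ [seq x <- s | x != n].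
Proof.
have geq_trans : transitive geq by move=> y x z /= yx zy; apply: leq_trans yx.
have geq_anti : antisymmetric geq by move=> x y /=; lia.
move=> s_sorted s_le; apply: (sorted_eq geq_trans geq_anti) => //.
  rewrite sorted_nseq_cat; first exact: sorted_filter.
  by rewrite all_filter; apply: sub_all s_le => x /= ->; rewrite implybT.
have /all_pred1P E := filter_all (pred1 n) s; rewrite size_filter in E.
by rewrite -E perm_sym perm_filterC.
Qed.

Lemma p3list_le A n s : s \in p3list A n -> all (geq n) s.
Proof.
elim: n s => [|n IH] s; first by rewrite inE => /eqP->.
rewrite p3listS; case: ifP => _; last by move=> /IH; apply: sub_all => x /= /leqW.
case/allpairsPdep=> [c [t [_ /IH t_le ->]]]; rewrite all_cat all_nseq /= leqnn orbT.
by apply: sub_all t_le => x /= /leqW.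
Qed.

Lemma p3list_uniq A n : uniq (p3list A n).
Proof.
elim: n => // n IH; rewrite p3listS; case: (A n.+1) => //.
apply: allpairs_uniq => // -[c s] [c' s'] /allpairsPdep[c1 [s1 [_ s1L [-> ->]]]].
case/allpairsPdep=> [c2 [s2 [_ s2L [-> ->]]]] /= E.
(* Tails contain no part n+1, so counting n+1 recovers the multiplicity. *)
have notin t : t \in p3list A n -> count_mem n.+1 t = 0%N.
  move=> /p3list_le t_le; apply/count_memPn/negP => /(allP t_le) /=.
  by rewrite ltnn.
have := congr1 (count_mem n.+1) E.
rewrite !count_cat !count_nseq /= eqxx !mul1n !notin // !addn0 => cc.
by move: E; rewrite cc => /eqP; rewrite eqseq_cat // eqxx => /eqP->.
Qed.

Lemma mem_p3list A n s :
  (s \in p3list A n) = [&& P3 s, all A s & all (geq n) s].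
Proof.
elim: n s => [|n IH] s.
  rewrite inE; case: s => // x s; apply/esym/negP.
  by case/and3P=> /andP[/andP[_ /= /andP[x_gt0 _]] _] _ /= /andP[]; lia.
have filter_le t : all (geq n.+1) t -> all (geq n) [seq x <- t | x != n.+1].
  rewrite all_filter; apply: sub_all => x /= le_x; apply/implyP; lia.
rewrite p3listS; case: ifP => An; last first.
  rewrite IH; apply/idP/idP => /and3P[Ps As le_s]; rewrite Ps As /=.
    by apply: sub_all le_s => x /= /leqW.
  apply/allP => x xs; have := allP le_s x xs => /=; rewrite leq_eqVlt.
  by case/orP=> [/eqP xE|//]; have := allP As x xs; rewrite xE An.
apply/idP/idP => [|/and3P[Ps As le_s]].
  case/allpairsPdep=> [c [t [c_lt]]]; rewrite IH => /and3P[Pt At le_t] ->.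
  have le_t' : all (geq n.+1) t by apply: sub_all le_t => x /= /leqW.
  have cnt0 : count_mem n.+1 t = 0%N.
    by apply/count_memPn/negP => /(allP le_t) /=; rewrite ltnn.
  move: Pt => /andP[/andP[t_sorted t_pos] t_cnt].
  apply/and3P; split; last 2 first.
  - by rewrite all_cat At all_nseq An orbT.
  - by rewrite all_cat le_t' all_nseq /= leqnn orbT.
  rewrite /P3 /is_partition sorted_nseq_cat // t_sorted !all_cat t_pos all_nseq orbT /=.
  have c_le : (c <= 3)%N by move: c_lt; rewrite mem_iota.
  apply/andP; split.
    by rewrite all_nseq count_cat count_nseq /= eqxx mul1n cnt0 addn0 c_le orbT.
  apply/allP => x xt; rewrite count_cat count_nseq /=.
  case: eqP => [xE|_]; last by rewrite add0n (allP t_cnt).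
  by move: xt; rewrite -xE -has_pred1 has_count cnt0.
(* Conversely, removing the leading copies of n+1 leaves parts at most n. *)
move: (Ps) => /andP[/andP[s_sorted s_pos] s_cnt].
rewrite (sorted_decomp s_sorted le_s); apply: allpairs_f.
  rewrite mem_iota /= add0n ltnS; case: (boolP (n.+1 \in s)) => [ns|].
    exact: (allP s_cnt).
  by move/count_memPn->.
rewrite IH /P3 /is_partition filter_le // andbT -!andbA; apply/and4P; split.
- by apply: sorted_filter => //; move=> y x z /= yx zy; apply: leq_trans yx.
- by rewrite all_filter; apply: sub_all s_pos => x /= ->; rewrite implybT.
- apply/allP => x; rewrite mem_filter => /andP[_ xs].
  apply: leq_trans (allP s_cnt x xs).
  exact/leq_count_subseq/filter_subseq.
- by rewrite all_filter; apply: sub_all As => x /= ->; rewrite implybT.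
Qed.

(** * Generating functions of the enumerations *)

Definition gf (T : Type) (wt : T -> nat) (L : seq T) : {poly int} :=
  \sum_(x <- L) 'X^(wt x).

Lemma coef_gf (T : Type) (wt : T -> nat) (L : seq T) n :
  (gf wt L)`_n = (count (fun x => wt x == n) L)%:R.
Proof.
rewrite /gf; elim: L => [|x L IH]; first by rewrite big_nil coef0.
by rewrite big_cons coefD IH coefXn /= natrD eq_sym.
Qed.

Lemma gf_allpairs (S T : Type) (wS : S -> nat) (wT : T -> nat) L K :
  gf (fun x => wS x.1 + wT x.2)%N [seq (x, y) | x <- L, y <- K] =
  gf wS L * gf wT K.
Proof.
rewrite /gf big_allpairs mulr_suml; apply: eq_bigr => x _.
by rewrite mulr_sumr; apply: eq_bigr => y _; rewrite exprD.
Qed.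

Definition p3factor k : {poly int} := 1 + 'X^k + 'X^(2 * k) + 'X^(3 * k).

Lemma gf_p3list A n :
  gf weight (p3list A n) = \prod_(1 <= k < n.+1 | A k) p3factor k.
Proof.
elim: n => [|n IH]; first by rewrite /gf big_seq1 big_nil.
have -> : \prod_(1 <= k < n.+2 | A k) p3factor k =
    gf weight (p3list A n) * (if A n.+1 then p3factor n.+1 else 1).
  by rewrite IH big_mkcond big_nat_recr //= -big_mkcond.
rewrite p3listS.
case: ifP => _; last by rewrite mulr1.
have shift c : \sum_(s <- p3list A n) 'X^(weight (nseq c n.+1 ++ s)) =
    gf weight (p3list A n) * 'X^(c * n.+1).
  rewrite /gf mulr_suml; apply: eq_bigr => s _.
  by rewrite /weight sumn_cat sumn_nseq exprD mulrC mulnC.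
rewrite {1}/gf big_allpairs_dep; under eq_bigr do rewrite shift.
rewrite -mulr_sumr (_ : iota 0 4 = [:: 0; 1; 2; 3]%N) // !big_cons big_nil /=.
by rewrite /p3factor mul0n mul1n; ring.
Qed.

Lemma p3factor_geometric k : p3factor k * (1 - 'X^k) = 1 - 'X^(4 * k).
Proof. by rewrite /p3factor !(mulnC _ k) !exprM; ring. Qed.

Lemma gf_P3 n : gf weight (p3list predT n) * eta 1 n = eta 4 n.
Proof.
rewrite gf_p3list -big_split; apply: eq_bigr => k _.
by rewrite /= mul1n p3factor_geometric.
Qed.

(** The bound 2m admits exactly the odd parts 2k+1 with k < m. *)
Lemma gf_P3o m : gf weight (p3list odd (2 * m)) * eta_odd 1 m = eta_odd 4 m.
Proof.
have -> : gf weight (p3list odd (2 * m)) = \prod_(0 <= k < m) p3factor (2 * k + 1).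
  rewrite gf_p3list; elim: m => [|m IH]; first by rewrite !big_nil.
  rewrite (_ : 2 * m.+1 = (2 * m).+2)%N ?mulnS // [RHS]big_nat_recr //= -IH.
  rewrite [LHS]big_mkcond [X in _ = X * _]big_mkcond 2?big_nat_recr //=.
  by rewrite !oddM /= mulr1 addn1.
rewrite /eta_odd -big_split; apply: eq_bigr => k _.
by rewrite /= mul1n p3factor_geometric.
Qed.

(** [P3] contributes f_4 / f_1 and [P3o] contributes f_2 f_4 / (f_1 f_8); the product is F. *)
Lemma gf_P3o_P3 N (L := gf weight (p3list odd (2 * N)))
    (K := gf weight (p3list predT (2 * N))) :
  eqmodX (2 * N) (L * K * eta 1 (2 * N) ^+ 2 * eta 8 (2 * N))
    (eta 2 (2 * N) * eta 4 (2 * N) ^+ 2).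
Proof.
(* With f_8 and f_2 cut at N, and f_1 and f_4 at 2N, the identity becomes exact. *)
rewrite -(@eta_stable (2 * N) 8 N) -?(@eta_stable (2 * N) 2 N); try lia.
apply: eq_eqmodX; rewrite [in RHS]expr2 -{1}gf_P3 (eta_parity 4) -gf_P3o.
by rewrite (eta_parity 1) muln1; rewrite -/L -/K; ring.
Qed.

(** * Bijections from equal counts in each weight *)

Lemma graded_bijection (T U : eqType) (P : pred T) (Q : pred U)
    (eT : nat -> seq T) (eU : nat -> seq U) (wT : T -> nat) (wU : U -> nat)
    (t0 : T) (u0 : U) :
  (forall n, uniq (eT n)) -> (forall n, uniq (eU n)) ->
  (forall n x, (x \in eT n) = P x && (wT x == n)) ->
  (forall n y, (y \in eU n) = Q y && (wU y == n)) ->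
  (forall n, size (eT n) = size (eU n)) ->
  exists f : {x | P x} -> {y | Q y},
    bijective f /\ forall x, wU (sval (f x)) = wT (sval x).
Proof.
move=> uT uU memT memU sz.
(* Elements at the same position in the lists of equal weight correspond. On P and Q the index is in
   range because the sizes agree, so [nth] does not fall back on its default. *)
pose g x := nth u0 (eU (wT x)) (index x (eT (wT x))).
pose h y := nth t0 (eT (wU y)) (index y (eU (wU y))).
have gE x : P x -> g x \in eU (wT x).
  by move=> Px; rewrite mem_nth // -sz index_mem memT Px eqxx.
have hE y : Q y -> h y \in eT (wU y).
  by move=> Qy; rewrite mem_nth // sz index_mem memU Qy eqxx.
have gP x (Px : P x) : Q (g x) by have := gE x Px; rewrite memU => /andP[].
have hP y (Qy : Q y) : P (h y) by have := hE y Qy; rewrite memT => /andP[].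
have gw x : P x -> wU (g x) = wT x by move/gE; rewrite memU => /andP[_ /eqP].
have hw y : Q y -> wT (h y) = wU y by move/hE; rewrite memT => /andP[_ /eqP].
exists (fun x => exist _ (g (sval x)) (gP _ (svalP x))); split; last first.
  by move=> [x Px] /=; apply: gw.
exists (fun y => exist _ (h (sval y)) (hP _ (svalP y))) => [[x Px]|[y Qy]].
  apply: val_inj; rewrite /= /h gw // /g index_uniq ?nth_index //.
    by rewrite memT Px eqxx.
  by rewrite -sz index_mem memT Px eqxx.
apply: val_inj; rewrite /= /g hw // /h index_uniq ?nth_index //.
  by rewrite memU Qy eqxx.
by rewrite sz index_mem memU Qy eqxx.
Qed.

(** * The weight-halving bijection *)

Definition wt2 (x : seq nat * seq nat) : nat := (weight x.1 + weight x.2)%N.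

Definition wt4 (y : (seq nat * seq nat) * (seq nat * seq nat)) : nat :=
  (wt2 y.1 + wt2 y.2)%N.

Definition p3pairs (A B : pred nat) n : seq (seq nat * seq nat) :=
  [seq (s, t) | s <- p3list A n, t <- p3list B n].

(** Here n is half the weight. The bound 2(n+1) loses no part, and [gf_P3o_P3] at N = n+1 is precise
    enough for degree 2n. *)
Definition dom_list n : seq (seq nat * seq nat) :=
  [seq x <- p3pairs odd predT (2 * n.+1) | wt2 x == (2 * n)%N].

Definition cod_list n : seq ((seq nat * seq nat) * (seq nat * seq nat)) :=
  [seq y <- [seq (s, t) | s <- p3pairs odd odd (2 * n.+1),
                          t <- p3pairs predT predT (2 * n.+1)]
   | wt4 y == n].

(** With a common bound on parts, the unfiltered codomain has as generating polynomial the square of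
    that of the domain, so [even_part_sqr] compares the two coefficients. *)
Lemma size_dom_cod n : size (dom_list n) = size (cod_list n).
Proof.
rewrite !size_filter; apply/eqP; rewrite -(@eqr_nat int) -!coef_gf; apply/eqP.
have := even_part_sqr (leqnn _) (@gf_P3o_P3 n.+1) (ltnSn n).
rewrite coef_even_poly -mul2n /dom_list.
by rewrite !gf_allpairs => ->; congr (polyseq _)`_ _; ring.
Qed.

Lemma all_geq_weight s n : (weight s <= n)%N -> all (geq n) s.
Proof.
move=> le_s; apply/allP => x xs /=; apply: leq_trans le_s.
by rewrite /weight; elim: s xs => //= y s IH; rewrite inE => /orP[/eqP->|/IH]; lia.
Qed.

Lemma mem_pairs (S T : eqType) (L : seq S) (K : seq T) z :
  (z \in [seq (x, y) | x <- L, y <- K]) = (z.1 \in L) && (z.2 \in K).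
Proof.
apply/allpairsP/andP => [[[x y] [xL yK ->]] //|[z1L z2K]].
by exists z; split => //; case: z {z1L z2K}.
Qed.

Lemma uniq_pairs (S T : eqType) (L : seq S) (K : seq T) :
  uniq L -> uniq K -> uniq [seq (x, y) | x <- L, y <- K].
Proof. by move=> uL uK; apply: allpairs_uniq => // -[x y] [x' y'] _ _. Qed.

Lemma mem_p3pairs A B n x : (wt2 x <= n)%N ->
  (x \in p3pairs A B n) = (P3 x.1 && all A x.1) && (P3 x.2 && all B x.2).
Proof.
rewrite /wt2 => le_x; rewrite mem_pairs !mem_p3list.
by rewrite (@all_geq_weight x.1) ?(@all_geq_weight x.2) ?andbT //; lia.
Qed.

Lemma mem_dom_list (n : nat) x : (x \in dom_list n) =
  P3o x.1 && P3 x.2 && ~~ odd (wt2 x) && ((wt2 x)./2 == n).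
Proof.
rewrite mem_filter -andbA.
have -> : ~~ odd (wt2 x) && ((wt2 x)./2 == n) = (wt2 x == (2 * n)%N) by lia.
case: eqP => [E|_]; last by rewrite andbF.
by rewrite mem_p3pairs ?E ?all_predT ?andbT //; lia.
Qed.

Lemma mem_cod_list (n : nat) y : (y \in cod_list n) =
  [&& P3o y.1.1, P3o y.1.2, P3 y.2.1 & P3 y.2.2] && (wt4 y == n).
Proof.
rewrite mem_filter andbC; case: eqP => [E|_]; last by rewrite !andbF.
have [le1 le2] : (wt2 y.1 <= 2 * n.+1)%N /\ (wt2 y.2 <= 2 * n.+1)%N.
  have E' : (wt2 y.1 + wt2 y.2 = n)%N := E.
  by clear E; lia.
by rewrite mem_pairs !mem_p3pairs // !all_predT !andbT /P3o -!andbA.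
Qed.

Lemma P3_bijection : exists f : DomEven -> Cod4,
  bijective f /\ forall x, (2 * weight_cod (f x))%N = weight_dom x.
Proof.
(* The domain is graded by half its weight; evenness makes this halving exact. *)
have [] := @graded_bijection _ _
  (fun x => P3o x.1 && P3 x.2 && ~~ odd (wt2 x))
  (fun y => [&& P3o y.1.1, P3o y.1.2, P3 y.2.1 & P3 y.2.2])
  dom_list cod_list (fun x => (wt2 x)./2) wt4
  ([::], [::]) (([::], [::]), ([::], [::])).
- by move=> n; rewrite filter_uniq ?uniq_pairs ?p3list_uniq.
- by move=> n; rewrite filter_uniq ?uniq_pairs ?p3list_uniq.
- exact: mem_dom_list.
- exact: mem_cod_list.
- exact: size_dom_cod.
move=> f [f_bij f_wt]; exists f; split => // x; move: (f_wt x).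
rewrite /weight_cod /weight_dom -addnA -/(wt2 _) -/(wt2 _) -/(wt2 _) -/(wt4 _) => ->.
by case: x => x /= /andP[_ ev]; rewrite /wt2 in ev *; lia.
Qed.

Theorem theorem2p11 :
  (exists f : DomEven -> Cod4,
      bijective f /\ forall x, (2 * weight_cod (f x))%N = weight_dom x)
  /\
  (forall P : nat -> int, is_gf_P P ->
      forall n, P (2 * n)%N = fps_mul P P n).
Proof. by split; [exact: P3_bijection | exact: gf_convolutive]. Qed.
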